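(* Let $m,n,k$ be positive integers, let $\Omega\subset\mathbb{C}^m$ be a bounded domain, let $\mathbf{T}=(T_1,\dots,T_m)$ (acting on $\mathcal{H}$) and $\widetilde{\mathbf{T}}=(\widetilde T_1,\dots,\widetilde T_m)$ (acting on $\widetilde{\mathcal{H}}$) be operator tuples in the class $\mathcal{B}_n^m(\Omega)$, and let $\mathbf{z}\in\Omega$. Let $H_{\mathbf z}^k$, $K_{\mathbf z}^{IJ}$ be the $k$-th order localization and the associated operators on $H_{\mathbf z}^1$ for $\mathbf{T}$, and let $\widetilde H_{\mathbf z}^k$, $\widetilde K_{\mathbf z}^{IJ}$ be the corresponding objects for $\widetilde{\mathbf{T}}$ (as defined in the context, with this $k$). Then the tuples $\mathbf{T}|_{H_{\mathbf z}^k}$ and $\widetilde{\mathbf{T}}|_{\widetilde H_{\mathbf z}^k}$ are unitarily equivalent if and only if the operator tuples $\{K_{\mathbf z}^{IJ} : 1\le |I|,|J|\le k-1\}$ and $\{\widetilde K_{\mathbf z}^{IJ} : 1\le |I|,|J|\le k-1\}$ are unitarily equivalent.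
   Context: Hilbert spaces are complex and separable. A commuting $m$-tuple $\mathbf{T}=(T_1,\dots,T_m)$ of bounded operators on a Hilbert space $\mathcal{H}$ belongs to $\mathcal{B}_n^m(\Omega)$ if: (i) for every $\mathbf{z}=(z_1,\dots,z_m)\in\Omega$ the space $\{((T_1-z_1)h,\dots,(T_m-z_m)h) : h\in\mathcal{H}\}$ is closed in $\mathcal{H}\oplus\cdots\oplus\mathcal{H}$ ($m$ copies); (ii) $\dim\bigcap_{i=1}^m\ker(T_i-z_i)=n$ for every $\mathbf{z}\in\Omega$; (iii) the closed linear span of $\bigcup_{\mathbf{z}\in\Omega}\bigcap_{i=1}^m\ker(T_i-z_i)$ is $\mathcal{H}$. For a multi-index $I=(i_1,\dots,i_m)$ of nonnegative integers, $|I|=i_1+\cdots+i_m$ and $(\mathbf{T}-\mathbf{z})^I=(T_1-z_1)^{i_1}\cdots(T_m-z_m)^{i_m}$. The $k$-th order localization space at $\mathbf{z}$ is $H_{\mathbf z}^k=\bigcap_{|I|=k}\ker(\mathbf{T}-\mathbf{z})^I$; in particular $H_{\mathbf z}^1=\bigcap_{i=1}^m\ker(T_i-z_i)\subseteq H_{\mathbf z}^k$. It is finite dimensional and invariant under each $T_i$, and $\mathbf{T}|_{H_{\mathbf z}^k}=(T_1|_{H_{\mathbf z}^k},\dots,T_m|_{H_{\mathbf z}^k})$. For fixed $k$, put $N_{\mathbf z}^I=(\mathbf{T}-\mathbf{z})^I|_{H_{\mathbf z}^k}$, an operator on $H_{\mathbf z}^k$, with adjoint $(N_{\mathbf z}^I)^*$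 taken in $H_{\mathbf z}^k$. For multi-indices $I,J$ define the operator $K_{\mathbf z}^{IJ}=P_{H_{\mathbf z}^1}\,[N_{\mathbf z}^I(N_{\mathbf z}^J)^*]\,|_{H_{\mathbf z}^1}$ on $H_{\mathbf z}^1$, where $P_{H_{\mathbf z}^1}$ is the orthogonal projection onto $H_{\mathbf z}^1$. The objects with tildes are defined in the same way from $\widetilde{\mathbf{T}}$. Two families of operators $\{A_\alpha\}$ on $X$ and $\{\widetilde A_\alpha\}$ on $\widetilde X$ with the same index set are unitarily equivalent if there is a single unitary $U:X\to\widetilde X$ with $UA_\alpha=\widetilde A_\alpha U$ for all $\alpha$. *)

(* Defs.v *)
From HB Require Import structures.
From mathcomp Require Import all_boot all_order all_algebra.
From mathcomp Require Import sesquilinear.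
From mathcomp Require Import complex.
From mathcomp Require Import all_classical all_reals all_analysis.

Set Implicit Arguments.
Unset Strict Implicit.
Unset Printing Implicit Defensive.

Import Order.TTheory GRing.Theory Num.Theory.
Import numFieldNormedType.Exports.

Local Open Scope classical_set_scope.
Local Open Scope ring_scope.

(* The field R[i], presented as a numClosedFieldType: the topology and the
   normed-module structure of a scalar field are attached to the sort of such
   a structure, and are not found on the raw type R[i]. *)
Definition Cplx (R : realType) : numClosedFieldType := R[i].

(* The form is linear in its first argument and conjugate-linear in the
   second one. *)
Record hilbertType (R : realType) := HilbertType {
  hilbert_sort :> completeNormedModType (Cplx R) ;
  inner : {dot hilbert_sort for (@Num.conj (Cplx R))} ;
  normr_inner : forall x : hilbert_sort, `|x| ^+ 2 = inner x x ;
  hilbert_separable : exists D : set hilbert_sort, countable D /\ dense D }.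

Section Hilbert.
Context {R : realType} {H : hilbertType R}.
Local Notation C := (Cplx R).
Implicit Types (X : set H) (A : H -> H).

Definition bounded_operator A := exists M : C, forall x, `|A x| <= M * `|x|.

Definition linear_span X : set H :=
  [set x | exists (p : nat) (c : 'I_p -> C) (v : 'I_p -> H),
     (forall i, X (v i)) /\ x = \sum_i c i *: v i].

(* Some family of n vectors is a basis of X: taking coordinates is a
   bijection between C^n and X. *)
Definition has_dim (n : nat) X :=
  exists e : 'I_n -> H,
    set_bij [set: 'rV[C]_n] X (fun c : 'rV[C]_n => \sum_i c ord0 i *: e i).

(* Value at x of the orthogonal projection onto X; it is the intended vector
   whenever X is a complete subspace, in particular for finite-dimensional X. *)
Definition orthoproj X (x : H) : H :=
  xget 0 [set u | X u /\ forall v, X v -> inner H (x - u) v = 0].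

(* Value at y of the adjoint, in the space X, of the restriction of A to X; it
   is the intended vector whenever X is a finite-dimensional subspace invariant
   under A and y belongs to X. *)
Definition adjoint_in X A (y : H) : H :=
  xget 0 [set u | X u /\ forall x, X x -> inner H (A x) y = inner H x u].

End Hilbert.

Section UnitaryEquivalence.
Context {R : realType} {H H' : hilbertType R}.

(* Only the values of U on X are relevant. *)
Definition unitary (X : set H) (X' : set H') (U : H -> H') :=
  [/\ set_bij X X' U,
      forall (a : Cplx R) x y, X x -> X y -> U (a *: x + y) = a *: U x + U y
    & forall x y, X x -> X y -> inner H' (U x) (U y) = inner H x y].

(* Families indexed by the elements of D, of operators on X and on X'. *)
Definition unitarily_equivalent (I : Type) (D : set I)
    (X : set H) (A : I -> H -> H) (X' : set H') (A' : I -> H' -> H') :=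
  exists2 U : H -> H', unitary X X' U &
    forall i, D i -> forall x, X x -> U (A i x) = A' i (U x).

End UnitaryEquivalence.

Definition multi_index (m : nat) := {ffun 'I_m -> nat}.

Definition mdegree (m : nat) (I : multi_index m) : nat := (\sum_i I i)%N.

Section Tuples.
Context {R : realType} {H : hilbertType R} {m : nat}.
Local Notation C := (Cplx R).
Variable T : 'I_m -> {linear H -> H}.
Implicit Types (z : 'rV[C]_m) (I J : multi_index m).

Definition shift_op z (i : 'I_m) (h : H) : H := T i h - z ord0 i *: h.

Definition shift_pow z I : H -> H :=
  \big[(fun f g : H -> H => f \o g)/idfun]_(i < m) iter (I i) (shift_op z i).

Definition joint_ker z : set H := [set h | forall i, shift_op z i h = 0].

Definition class_B (n : nat) (Omega : set 'rV[C]_m) :=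
  [/\ (forall i, bounded_operator (T i))
      /\ (forall i j h, T i (T j h) = T j (T i h)),
      (* the product topology is the one of the Hilbert direct sum *)
      forall z, Omega z ->
        closed (range (fun h => (fun i => shift_op z i h) : {ptws 'I_m -> H})),
      forall z, Omega z -> has_dim n (joint_ker z)
    & closure (linear_span (\bigcup_(z in Omega) joint_ker z)) = setT].

Definition localization (k : nat) z : set H :=
  [set h | forall I, mdegree I = k -> shift_pow z I h = 0].

Definition K_op (k : nat) z I J (h : H) : H :=
  orthoproj (localization 1 z)
    (shift_pow z I (adjoint_in (localization k z) (shift_pow z J) h)).

End Tuples.

Definition K_indices (m k : nat) : set (multi_index m * multi_index m) :=
  [set IJ | (1 <= mdegree IJ.1 <= k - 1)%N && (1 <= mdegree IJ.2 <= k - 1)%N].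

Arguments K_indices : clear implicits.

Definition bounded_domain (R : realType) (m : nat)
    (Omega : set 'rV[Cplx R]_m) :=
  [/\ open Omega, connected Omega, Omega !=set0 & bounded_set Omega].

(* Main.v *)
From HB Require Import structures.
Require Import Defs.
From mathcomp Require Import all_boot all_order all_algebra.
From mathcomp Require Import sesquilinear.
From mathcomp Require Import all_classical all_reals all_analysis.

(* H^k is finite dimensional, and a vector x of H^k orthogonal to every
   (N^J)^* h with h in H^1 vanishes: if N^I x = 0 for |I| = j + 1, then N^J x
   lies in H^1 for |J| = j, so <N^J x, h> = 0 for all h in H^1 forces
   N^J x = 0, and one descends on j. Hence these vectors span H^k, and their
   inner products <(N^J)^* h, (N^I)^* g> = <K^{IJ} h, g> are determined by the
   operators K^{IJ}. A unitary V of the first order spaces intertwining the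
   K^{IJ} thus extends to the unitary sending (N^J)^* h to (N'^J)^* (V h), which
   intertwines the adjoints of the N_i, hence the N_i. *)

(** * Frames, projections and adjoints on finite-dimensional subspaces *)

Section InnerProduct.
Set Implicit Arguments.
Unset Strict Implicit.
Import Order.TTheory GRing.Theory Num.Theory.
Local Open Scope classical_set_scope.
Local Open Scope ring_scope.
Context {R : realType} {H : hilbertType R}.
Local Notation C := (Cplx R).
Local Notation "<| x , y |>" := (inner H x y) (at level 0, x, y at level 99).
Implicit Types (X G : set H) (s : seq H).

Lemma innerC (x y : H) : <|x, y|> = <|y, x|>^*.
Proof. by rewrite [LHS]hermC /= expr0 mul1r. Qed.

Lemma innerDl (x y w : H) : <|x + y, w|> = <|x, w|> + <|y, w|>.
Proof. by rewrite linearDl. Qed.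

Lemma innerDr (x y w : H) : <|w, x + y|> = <|w, x|> + <|w, y|>.
Proof. by rewrite linearDr. Qed.

Lemma innerZl (a : C) (x y : H) : <|a *: x, y|> = a * <|x, y|>.
Proof. by rewrite linearZl_LR. Qed.

Lemma innerZr (a : C) (x y : H) : <|x, a *: y|> = a^* * <|x, y|>.
Proof. by rewrite linearZr. Qed.

Lemma innerZDl (a : C) (x y w : H) :
  <|a *: x + y, w|> = a * <|x, w|> + <|y, w|>.
Proof. by rewrite innerDl innerZl. Qed.

Lemma innerZDr (a : C) (x y w : H) :
  <|w, a *: x + y|> = a^* * <|w, x|> + <|w, y|>.
Proof. by rewrite innerDr innerZr. Qed.

Lemma innerBl (x y w : H) : <|x - y, w|> = <|x, w|> - <|y, w|>.
Proof. by rewrite linearBl. Qed.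

Lemma inner_suml s (F : H -> H) w :
  <|\sum_(e <- s) F e, w|> = \sum_(e <- s) <|F e, w|>.
Proof. by rewrite linear_sumlz. Qed.

Lemma inner_sumr s (F : H -> H) w :
  <|w, \sum_(e <- s) F e|> = \sum_(e <- s) <|w, F e|>.
Proof. by rewrite linear_sumr. Qed.

Lemma inner_eq0 (x : H) : <|x, x|> = 0 -> x = 0.
Proof. by move/eqP; rewrite dnorm_eq0 => /eqP. Qed.

Definition subspace X := X 0 /\ forall (a : C) x y, X x -> X y -> X (a *: x + y).

Lemma subspaceB X x y : subspace X -> X x -> X y -> X (x - y).
Proof. by move=> [_ XP] Xx Xy; rewrite addrC -scaleN1r; apply: XP. Qed.

Lemma subspaceZ X (a : C) x : subspace X -> X x -> X (a *: x).
Proof. by move=> [X0 XP] Xx; rewrite -[_ *: _]addr0; apply: XP. Qed.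

Lemma subspace_inner_ext X x y : subspace X -> X x -> X y ->
  (forall v, X v -> <|x, v|> = <|y, v|>) -> x = y.
Proof.
move=> sX Xx Xy xy; apply/eqP; rewrite -subr_eq0; apply/eqP/inner_eq0.
by rewrite innerBl xy ?subrr//; apply: subspaceB.
Qed.

(* A Parseval frame of X: orthonormality is never needed, only the
   reconstruction formula. *)
Definition frame s X :=
  (forall e, e \in s -> X e) /\
  forall x, X x -> x = \sum_(e <- s) <|x, e|> *: e.

Definition framed X := exists s, frame s X.

Definition frame_proj s (x : H) : H := \sum_(e <- s) <|x, e|> *: e.

Lemma frame_proj_in s X x : subspace X -> frame s X -> X (frame_proj s x).
Proof.
move=> [X0 XP] [sX _]; rewrite /frame_proj.
elim: s sX => [|e s IH] sX; first by rewrite big_nil.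
rewrite big_cons; apply: XP; first by apply: sX; rewrite mem_head.
by apply: IH => f fs; apply: sX; rewrite inE fs orbT.
Qed.

Lemma frame_proj_inner s X x v : frame s X -> X v ->
  <|frame_proj s x, v|> = <|x, v|>.
Proof.
move=> [sX sP] Xv; rewrite [in RHS](sP v Xv) /frame_proj inner_suml inner_sumr.
by apply: eq_bigr => e _; rewrite innerZl innerZr -innerC mulrC.
Qed.

Lemma framed0 : framed [set 0].
Proof. by exists [::]; split => // x ->; rewrite big_nil. Qed.

(** One Gram-Schmidt step: if [w], the part of [v] orthogonal to [X], is zero, the old frame serves;
    otherwise its normalization [u] joins the frame. *)
Lemma framed_add X (v : H) : subspace X -> framed X ->
  framed [set x | exists (a : C) y, X y /\ x = a *: v + y].
Proof.
move=> sX [s fs]; have [X0 XP] := sX; have [sX1 sP] := fs.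
pose p := frame_proj s v; pose w := v - p.
have Xp : X p by apply: frame_proj_in fs.
have wX y : X y -> <|w, y|> = 0.
  by move=> Xy; rewrite innerBl (frame_proj_inner _ fs)// subrr.
have vE : v = w + p by rewrite subrK.
have [w0|w0] := eqVneq w 0.
  exists s; split=> [e es|x [a [y [Xy ->]]]].
    by exists 0, e; rewrite scale0r add0r; split => //; exact: sX1.
  by apply: sP; apply: XP => //; rewrite vE w0 add0r.
pose c : C := `|w|^-1; pose u := c *: w.
have cc : c^* = c by apply: conj_Creal; rewrite realV normr_real.
have cw : c * (c * <|w, w|>) = 1.
  by rewrite -normr_inner expr2 /c mulKf ?mulVf ?normr_eq0.
exists (u :: s); split=> [e|x [a [y [Xy ->]]]].
  rewrite inE => /orP[/eqP ->|es]; last first.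
    by exists 0, e; rewrite scale0r add0r; split => //; exact: sX1.
  exists c, (- c *: p); split; first exact: subspaceZ.
  by rewrite /u /w scalerBr scaleNr.
have Xy1 : X (a *: p + y) by apply: XP.
have xE : a *: v + y = a *: w + (a *: p + y) by rewrite vE scalerDr addrA.
rewrite big_cons xE; congr (_ + _).
  rewrite innerZDl /u !innerZr cc (innerC (a *: p + y)) (wX _ Xy1) conjC0 mulr0 addr0.
  by rewrite scalerA -mulrA [_ * c]mulrC cw mulr1.
rewrite [LHS]sP//; apply: eq_big_seq => e es.
by rewrite [in RHS]innerZDl wX ?mulr0 ?add0r//; exact: sX1.
Qed.

Lemma span_subspace n (e : 'I_n -> H) :
  subspace [set x | exists c : 'I_n -> C, x = \sum_i c i *: e i].
Proof.
split; first by exists (fun=> 0); rewrite big1// => i _; rewrite scale0r.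
move=> a _ _ [c ->] [d ->]; exists (fun i => a * c i + d i).
rewrite scaler_sumr -big_split; apply: eq_bigr => i _ /=.
by rewrite scalerDl scalerA.
Qed.

Lemma framed_span n (e : 'I_n -> H) :
  framed [set x | exists c : 'I_n -> C, x = \sum_i c i *: e i].
Proof.
elim: n e => [|n IH] e.
  rewrite (_ : [set x | _] = [set 0]); first exact: framed0.
  apply/seteqP; split=> x /=; first by move=> [c ->]; rewrite big_ord0.
  by move=> ->; exists (fun=> 0 : C); rewrite big_ord0.
set Y := [set x | exists c : 'I_n -> C, x = \sum_i c i *: e (lift ord0 i)].
have sY : subspace Y by apply: span_subspace.
rewrite (_ : [set x | _] =
    [set x | exists (a : C) y, Y y /\ x = a *: e ord0 + y]).
  by apply: framed_add => //; exact: IH.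
apply/seteqP; split=> x /=.
  move=> [c ->]; rewrite big_ord_recl.
  by do 2!eexists; split; last reflexivity; exists (c \o lift ord0).
move=> [a [_ [[c ->] ->]]].
exists (fun i => if unlift ord0 i is Some j then c j else a).
rewrite big_ord_recl unlift_none; congr (_ + _).
by apply: eq_bigr => i _; rewrite liftK.
Qed.

Lemma linear_on0 X (f : H -> C) : X 0 ->
  (forall (a : C) x y, X x -> X y -> f (a *: x + y) = a * f x + f y) ->
  f 0 = 0.
Proof.
move=> X0 fP; have := fP 1 0 0 X0 X0; rewrite scaler0 addr0 mul1r => /esym/eqP.
by rewrite -subr_eq0 addrK => /eqP.
Qed.

(** The kernel has codimension at most one: a vector [x0] with [f x0 <> 0] spans [X] together with
    the kernel, and if there is none the kernel is [X]. *)
Lemma framed_ker X (f : H -> C) : subspace X ->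
  (forall (a : C) x y, X x -> X y -> f (a *: x + y) = a * f x + f y) ->
  framed (X `&` [set x | f x = 0]) -> framed X.
Proof.
move=> sX fP; have [X0 XP] := sX; set K := X `&` _ => fK.
have f0 := linear_on0 X0 fP.
have sK : subspace K.
  split=> // a x y [Xx /= fx] [Xy /= fy]; split; first exact: XP.
  by rewrite /= fP// fx fy mulr0 addr0.
have [[x0 [Xx0 /eqP fx0]]|nex] := pselect (exists x, X x /\ f x <> 0).
  have -> : X = [set x | exists (a : C) y, K y /\ x = a *: x0 + y].
    apply/seteqP; split=> [x Xx|_ [a [y [[Xy _] ->]]]]; last exact: XP.
    exists (f x / f x0), (- (f x / f x0) *: x0 + x).
    rewrite scaleNr addrA subrr add0r; split=> //; split.
      by rewrite -scaleNr; apply: XP.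
    by rewrite /= -scaleNr fP// mulNr divfK// addNr.
  exact: framed_add.
have <- // : K = X.
apply/seteqP; split=> [x []|x Xx] //; split=> //=.
by apply: contrapT => fx; apply: nex; exists x.
Qed.

(** Induction on [r]: each functional adds at most one dimension to the common kernel. *)
Lemma framed_kers (I : eqType) (r : seq I) X (f : I -> H -> C) : subspace X ->
  (forall i, i \in r ->
    forall (a : C) x y, X x -> X y -> f i (a *: x + y) = a * f i x + f i y) ->
  framed (X `&` [set x | forall i, i \in r -> f i x = 0]) -> framed X.
Proof.
elim: r X => [|i r IH] X sX fP fK.
  by move: fK; rewrite (_ : [set x | _] = setT) ?setIT//; apply/seteqP.
have [X0 XP] := sX.
have fiP := fP i (mem_head _ _); apply: (framed_ker sX fiP).
have f0 := linear_on0 X0 fiP.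
apply: IH.
- split=> // a x y [Xx /= fx] [Xy /= fy]; split; first exact: XP.
  by rewrite /= fiP// fx fy mulr0 addr0.
- move=> j jr a x y [Xx _] [Xy _]; apply: fP => //.
  by rewrite inE jr orbT.
- move: fK; congr framed; apply/seteqP; split=> x /=.
    move=> [Xx fx]; split; first by split=> //; apply: fx; exact: mem_head.
    by move=> j jr; apply: fx; rewrite inE jr orbT.
  move=> [[Xx fix0] fx]; split=> // j; rewrite inE => /orP[/eqP -> //|].
  exact: fx.
Qed.

(** Pairings with the frame vectors of [X] are finitely many functionals separating the points of
    [X], so their common kernel in [G] is zero. *)
Lemma framed_sub X G : subspace G -> G `<=` X -> framed X -> framed G.
Proof.
move=> sG GX [s [sX sP]]; have [G0 _] := sG.
apply: (@framed_kers _ s _ (fun e x => <|x, e|>)) => //.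
  by move=> e _ a x y _ _; exact: innerZDl.
rewrite (_ : _ `&` _ = [set 0]); first exact: framed0.
apply/seteqP; split=> [x [Gx /= xs]|_ ->]; last first.
  by split=> // e _; rewrite linear0l.
rewrite (sP x (GX _ Gx)) big_seq big1// => e es.
by rewrite xs// scale0r.
Qed.

(** The difference of [x] and its projection onto [G] lies in [X] and is orthogonal to [G]. *)
Lemma sub_of_orthogonal0 X G : subspace X -> framed X ->
  subspace G -> G `<=` X ->
  (forall x, X x -> (forall g, G g -> <|x, g|> = 0) -> x = 0) -> X `<=` G.
Proof.
move=> sX fX sG GX ort x Xx; have [s fs] := framed_sub sG GX fX.
have Gp := frame_proj_in x sG fs.
suff /eqP : x - frame_proj s x = 0 by rewrite subr_eq0 => /eqP ->.
apply: ort => [|g Gg]; first by apply: subspaceB => //; exact: GX.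
by rewrite innerBl (frame_proj_inner _ fs)// subrr.
Qed.

(** The frame projection shows that the set given to [xget] is inhabited, so the default 0 is not
    what defines the value. *)
Lemma orthoprojP X x : subspace X -> framed X ->
  X (orthoproj X x) /\ forall v, X v -> <|orthoproj X x, v|> = <|x, v|>.
Proof.
move=> sX [s fs].
have : exists u, X u /\ forall v, X v -> <|x - u, v|> = 0.
  exists (frame_proj s x); split; first exact: frame_proj_in.
  by move=> v Xv; rewrite innerBl (frame_proj_inner _ fs)// subrr.
move=> /(xgetPex 0) [Xu uP]; split=> // v /uP /eqP.
by rewrite innerBl subr_eq0 => /eqP.
Qed.

Lemma adjoint_inP X (A : {linear H -> H}) y : framed X -> subspace X ->
  X (adjoint_in X A y) /\
  forall x, X x -> <|A x, y|> = <|x, adjoint_in X A y|>.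
Proof.
move=> [s [sX sP]] [X0 XP].
suff : exists u, X u /\ forall x, X x -> <|A x, y|> = <|x, u|>.
  by move=> /(xgetPex 0).
(* The Riesz vector of the functional sending [x] to [<|A x, y|>]; its coefficients are conjugates
   of the values at [e], the form being conjugate-linear on the right. *)
exists (\sum_(e <- s) <|y, A e|> *: e); split=> [|x Xx].
  rewrite big_seq; elim/big_rec: _ => // e u es Xu.
  by apply: XP => //; exact: sX.
rewrite [in LHS](sP x Xx) linear_sum inner_suml inner_sumr.
by apply: eq_bigr => e _; rewrite linearZ innerZl innerZr -innerC mulrC.
Qed.

End InnerProduct.

(** * Algebra and dimension of the localization spaces *)

Section Localization.
Set Implicit Arguments.
Unset Strict Implicit.
Import Order.TTheory GRing.Theory Num.Theory.
Local Open Scope classical_set_scope.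
Local Open Scope ring_scope.
Context {R : realType} {H : hilbertType R} {m : nat}.
Context (T : 'I_m -> {linear H -> H}) (z : 'rV[Cplx R]_m).
Local Notation "<| x , y |>" := (inner H x y) (at level 0, x, y at level 99).
Local Notation N := (shift_op T z).
Local Notation NN := (shift_pow T z).
Local Notation L k := (localization T k z).
Implicit Types (I J : multi_index m).

Fact shift_op_linear i : linear (N i).
Proof.
move=> a x y; rewrite /shift_op linearP scalerDr scalerBr !scalerA.
by rewrite [_ * a]mulrC opprD addrACA.
Qed.

HB.instance Definition _ i :=
  GRing.isLinear.Build _ _ _ _ (N i) (shift_op_linear i).

Fact shift_pow_linear I : linear (NN I).
Proof.
rewrite /shift_pow; elim/big_ind: _ => // [f g fl gl a x y|i _ a x y].
  by rewrite /= gl fl.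
by elim: (I i) => //= p ->; rewrite linearP.
Qed.

HB.instance Definition _ I :=
  GRing.isLinear.Build _ _ _ _ (NN I) (shift_pow_linear I).

Lemma mdegree0 I : mdegree I = 0%N -> I = [ffun=> 0%N].
Proof.
move=> /eqP; rewrite sum_nat_eq0 => /forallP I0; apply/ffunP => i.
by rewrite ffunE; apply/eqP; exact: I0.
Qed.

Lemma shift_pow0 x : NN [ffun=> 0%N] x = x.
Proof.
rewrite /shift_pow; elim/big_rec: _ => [//|i f _ fx].
by rewrite /= ffunE.
Qed.

Definition incr_index I i : multi_index m := [ffun j => (I j + (j == i))%N].

Lemma mdegree_incr I i : mdegree (incr_index I i) = (mdegree I).+1.
Proof.
rewrite /mdegree -addn1; under eq_bigr do rewrite ffunE.
rewrite big_split /=; congr (_ + _)%N.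
by rewrite (bigD1 i)//= eqxx big1 ?addn0// => j /negPf ->.
Qed.

Lemma mdegreeS I k : mdegree I = k.+1 ->
  exists i J, I = incr_index J i /\ mdegree J = k.
Proof.
move=> Ik; have [i Ii] : exists i, (0 < I i)%N.
  apply: contrapT => nI; move: Ik; rewrite /mdegree big1// => i _.
  by apply/eqP; rewrite -leqn0 leqNgt; apply/negP => Ii; apply: nI; exists i.
pose J : multi_index m := [ffun j => (I j - (j == i))%N].
have IJ : I = incr_index J i.
  apply/ffunP => j; rewrite !ffunE subnK//.
  by case: eqVneq => // ->.
by exists i, J; split => //; move: Ik; rewrite IJ mdegree_incr => -[].
Qed.

Context (TC : forall i j h, T i (T j h) = T j (T i h)).

Lemma shift_opC i j x : N i (N j x) = N j (N i x).
Proof.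
rewrite /shift_op !linearB !linearZ /= TC !scalerA [z _ j * _]mulrC.
exact: addrACA.
Qed.

(** An arbitrary list [r] is allowed because [shift_pow_incr] applies this to tails of the index
    enumeration. *)
Lemma shift_op_bigC (r : seq 'I_m) I i x :
  N i ((\big[(fun f g : H -> H => f \o g)/idfun]_(l <- r)
          iter (I l) (N l)) x) =
  (\big[(fun f g : H -> H => f \o g)/idfun]_(l <- r)
     iter (I l) (N l)) (N i x).
Proof.
elim/big_rec: _ => [//|l f _ fC] /=.
by elim: (I l) => [//|p IHp] /=; rewrite shift_opC IHp.
Qed.

Lemma shift_op_powC I i x : N i (NN I x) = NN I (N i x).
Proof. exact: shift_op_bigC. Qed.

Lemma shift_pow_incr I i x : NN (incr_index I i) x = NN I (N i x).
Proof.
rewrite /shift_pow; have := mem_index_enum i; have := index_enum_uniq 'I_m.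
(* The enumeration has no repetition, so exactly one factor gains an [N i], which then moves right
   through the later factors. *)
elim: (index_enum _) => // j r IH /= /andP[jr ur]; rewrite inE !big_cons /= eq_sym.
have [ji _|ij /= ir] := eqVneq j i.
  rewrite ffunE ji eqxx addn1 iterSr shift_op_bigC.
  congr (iter _ _ _); under eq_big_seq => l lr.
    rewrite ffunE (_ : l == i = false) ?addn0; first over.
    by apply: contraNF jr => /eqP li; rewrite ji -li.
  by [].
by rewrite ffunE (negPf ij) addn0 IH.
Qed.

Lemma localization0 : L 0%N = [set 0].
Proof.
apply/seteqP; split=> [x /(_ [ffun=> 0%N])|_ ->] /=.
  by rewrite shift_pow0; apply; rewrite /mdegree big1// => i _; rewrite ffunE.
by move=> I _; rewrite linear0.
Qed.

(** Every multi-index of degree [k.+1] is one of degree [k] with one entry raised. This recursion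
    drives the inductions on [k], starting from the zero space [L 0]. *)
Lemma localizationS k x : L k.+1 x <-> forall i, L k (N i x).
Proof.
split=> [Lx i I Ik|Lx I /mdegreeS [i [J [-> Jk]]]].
  by rewrite -shift_pow_incr; apply: Lx; rewrite mdegree_incr Ik.
by rewrite shift_pow_incr; exact: Lx.
Qed.

Lemma localization1 x : L 1%N x <-> forall i, N i x = 0.
Proof.
rewrite localizationS localization0; split=> Nx i; exact: Nx.
Qed.

Lemma localization_subspace k : subspace (L k).
Proof.
split=> [I _|a x y Lx Ly I Ik]; first by rewrite linear0.
by rewrite shift_pow_linear Lx// Ly// scaler0 addr0.
Qed.

Lemma localization_leS k : L k `<=` L k.+1.
Proof.
move=> x Lx; apply/localizationS => i I Ik.
by rewrite -shift_op_powC Lx// linear0.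
Qed.

Lemma localization_le k l : (k <= l)%N -> L k `<=` L l.
Proof.
elim: l => [|l IH]; first by rewrite leqn0 => /eqP ->.
rewrite leq_eqVlt => /orP[/eqP -> //|kl] x Lx.
by apply: localization_leS; exact: IH.
Qed.

Lemma shift_op_localization k i x : L k x -> L k (N i x).
Proof. by move=> /localization_leS/localizationS. Qed.

Lemma shift_pow_localization k I x : L k x -> L k (NN I x).
Proof.
rewrite /shift_pow; elim/big_rec: _ => [//|j f _ fC] /fC Lf /=.
by elim: (I j) => //= p; exact: shift_op_localization.
Qed.

Lemma shift_pow_eq0 k I x : (k <= mdegree I)%N -> L k x -> NN I x = 0.
Proof. by move=> /localization_le kI /kI; apply. Qed.

Lemma localization_test0 k x : L k x ->
  (forall I h, L 1%N h -> <|NN I x, h|> = 0) -> x = 0.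
Proof.
elim: k => [|k IH] Lx xh; first by move: Lx; rewrite localization0.
(* The test vector is [NN I x] itself; it lies in [L 1] because each [N i x] lies in [L k] and
   [NN I] has degree [k]. *)
apply: IH => // I Ik; apply: inner_eq0; apply: xh.
apply/localization1 => i; rewrite shift_op_powC.
by move/localizationS: Lx => /(_ i); apply.
Qed.

Lemma localization1_framed n : has_dim n (joint_ker T z) -> framed (L 1%N).
Proof.
move=> [e [eH _ eS]]; have := framed_span e; congr framed.
apply/seteqP; split=> x /=.
  move=> [c ->]; apply/localization1.
  have /= := eH (\row_i c i) I; under eq_bigr do rewrite mxE.
  exact.
move=> /localization1 /eS [c _ <-].
by exists (c ord0).
Qed.

(** The maps [N i] send [L k.+1] into [L k] with common kernel [L 1]. Pairing them with a frame of
    [L k] gives finitely many functionals with that same kernel. *)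
Lemma localization_framed n k : has_dim n (joint_ker T z) -> framed (L k).
Proof.
move=> /localization1_framed f1; elim: k => [|k [s [sL sP]]].
  by rewrite localization0; exact: framed0.
apply: (@framed_kers _ _ _ [seq (i, e) | i <- enum 'I_m, e <- s] _
  (fun p x => <|N p.1 x, p.2|>)).
- exact: localization_subspace.
- by move=> p _ a x y _ _; rewrite linearP innerZDl.
move: f1; congr framed; apply/seteqP; split=> x /=.
  move=> Lx; split; first exact: localization_le Lx.
  by move=> p _; move/localization1: Lx => ->; rewrite linear0l.
move=> [/localizationS Lx Nx]; apply/localization1 => i.
rewrite (sP _ (Lx i)) big_seq big1// => e es.
by rewrite (Nx (i, e)) ?scale0r//; apply/allpairsP; exists (i, e);
  split => //; rewrite mem_enum.
Qed.

(** * Adjoints in a localization space and their inner products *)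

Context (n : nat) (dimL : has_dim n (joint_ker T z)).

Local Notation adj k J := (adjoint_in (localization T k z) (shift_pow T z J)).

Lemma adjP k J y : L k (adj k J y) /\
  forall x, L k x -> <|NN J x, y|> = <|x, adj k J y|>.
Proof.
exact: (@adjoint_inP _ _ _ (NN J) y (localization_framed k dimL)
  (localization_subspace k)).
Qed.

Lemma K_opP k I J h : L 1%N (K_op T k z I J h) /\
  forall g, L 1%N g -> <|K_op T k z I J h, g|> = <|NN I (adj k J h), g|>.
Proof.
exact: (orthoprojP _ (localization_subspace 1) (localization_framed 1 dimL)).
Qed.

(** For [g] in [L 1] the right side is an entry of [K_op], by [K_opP]: the operators K are the Gram
    data of the adjoint vectors. *)
Lemma inner_adj k I J h g : <|adj k J h, adj k I g|> = <|NN I (adj k J h), g|>.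
Proof. by rewrite (adjP k I g).2//; exact: (adjP k J h).1. Qed.

(* The cases |I| = 0 excluded from the index set of the operators K. *)
Lemma inner_adj0 k J h g : (0 < k)%N -> L 1%N h -> L 1%N g ->
  <|adj k J h, adj k [ffun=> 0%N] g|> = if mdegree J == 0%N then <|h, g|> else 0.
Proof.
move=> k0 Lh Lg; have Lkg := localization_le k0 Lg.
(* Up to conjugation this is [<|NN J g, h|>], and [NN J] kills [g] in [L 1] as soon as [J] has
   positive degree. *)
rewrite inner_adj shift_pow0 innerC -(adjP k J h).2//.
case: eqP => [/mdegree0 ->|/eqP]; first by rewrite shift_pow0 -innerC.
by rewrite -lt0n => J0; rewrite (shift_pow_eq0 J0)// linear0l rmorph0.
Qed.

Lemma inner_adj_ge k I J h g : (k <= mdegree I)%N ->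
  <|adj k J h, adj k I g|> = 0.
Proof.
move=> kI; rewrite inner_adj (shift_pow_eq0 kI) ?linear0l//.
exact: (adjP k J h).1.
Qed.

End Localization.

(** * Restricting a unitary to the first order spaces, and tools for extending one *)

Section TwoTuples.
Set Implicit Arguments.
Unset Strict Implicit.
Import Order.TTheory GRing.Theory Num.Theory.
Local Open Scope classical_set_scope.
Local Open Scope ring_scope.
Context {R : realType} {H H' : hilbertType R} {m : nat}.
Context (T : 'I_m -> {linear H -> H}) (T' : 'I_m -> {linear H' -> H'}).
Context (z : 'rV[Cplx R]_m) (n k : nat) (k0 : (0 < k)%N).
Context (TC : forall i j h, T i (T j h) = T j (T i h)).
Context (TC' : forall i j h, T' i (T' j h) = T' j (T' i h)).
Context (dimL : has_dim n (joint_ker T z)).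
Context (dimL' : has_dim n (joint_ker T' z)).
Local Notation N := (shift_op T z).
Local Notation NN := (shift_pow T z).
Local Notation L k := (localization T k z).
Local Notation N' := (shift_op T' z).
Local Notation NN' := (shift_pow T' z).
Local Notation L' k := (localization T' k z).
Local Notation adj J := (adjoint_in (localization T k z) (shift_pow T z J)).
Local Notation adj' J := (adjoint_in (localization T' k z) (shift_pow T' z J)).
Implicit Types (I J : multi_index m).

(** A unitary intertwining the [T i] also intertwines the powers and their adjoints, and maps [L 1]
    onto [L' 1]; so its restriction intertwines the compressions [K_op]. *)
Lemma K_equivalence_of_localization :
  unitarily_equivalent setT (L k) (fun i => T i : H -> H)
    (L' k) (fun i => T' i : H' -> H') ->
  unitarily_equivalent (K_indices m k)
    (L 1%N) (fun IJ => K_op T k z IJ.1 IJ.2)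
    (L' 1%N) (fun IJ => K_op T' k z IJ.1 IJ.2).
Proof.
move=> [U [[UL Uinj Usurj] Ulin Uiso] UT].
have sL := localization_subspace T z k; have [L0 LP] := sL.
have sL' := localization_subspace T' z k.
have U0 : U 0 = 0 by apply: inner_eq0; rewrite Uiso// linear0l.
have UN i x : L k x -> U (N i x) = N' i (U x).
  move=> Lx; have LT : L k (T i x).
    rewrite -[T i x](subrK (z ord0 i *: x)) addrC.
    by apply: LP => //; exact: shift_op_localization.
  rewrite /shift_op addrC -scaleNr Ulin// UT//.
  by rewrite addrC scaleNr.
have UNN J x : L k x -> U (NN J x) = NN' J (U x).
  move=> Lx; rewrite /shift_pow.
  (* Membership in [L k] is carried through the induction since [UN] holds only there. *)
  suff: L k ((\big[(fun f g : H -> H => f \o g)/idfun]_(i < m)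
                iter (J i) (N i)) x) /\
        U ((\big[(fun f g : H -> H => f \o g)/idfun]_(i < m)
                iter (J i) (N i)) x) =
        (\big[(fun f g : H' -> H' => f \o g)/idfun]_(i < m)
                iter (J i) (N' i)) (U x) by case.
  elim/big_rec2: _ => [//|i f g _ [Lg Ug]] /=.
  elim: (J i) => [//|p [Lp Up]] /=; split.
    exact: shift_op_localization.
  by rewrite UN// Up.
have L1k : L 1%N `<=` L k := localization_le TC k0.
have L1k' : L' 1%N `<=` L' k := localization_le TC' k0.
have UL1 x : L 1%N x -> L' 1%N (U x).
  move=> Lx; apply/(localization1 _ TC') => i; rewrite -UN; last exact: L1k.
  by move/(localization1 _ TC) : Lx => ->.
have Usurj1 y : L' 1%N y -> exists2 x, L 1%N x & U x = y.
  move=> Ly; have [x Lx Ux] := Usurj _ (L1k' _ Ly).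
  (* [U] sends [N i x] to [N' i y], which is 0, so injectivity on [L k] puts [x] in [L 1]. *)
  exists x => //; apply/(localization1 _ TC) => i; apply: Uinj.
  - by rewrite inE; exact: shift_op_localization.
  - by rewrite inE.
  - by rewrite UN// Ux U0; move/(localization1 _ TC') : Ly => ->.
have Uadj J y : L k y -> U (adj J y) = adj' J (U y).
  move=> Ly; have [La aP] := adjP TC dimL k J y.
  have [La' aP'] := adjP TC' dimL' k J (U y).
  apply: (subspace_inner_ext sL') => // [|_ /Usurj [v Lv <-]]; first exact: UL.
  rewrite Uiso// innerC [RHS]innerC -aP// -aP'; last exact: UL.
  by rewrite -UNN// Uiso//; exact: shift_pow_localization.
exists U => [|[I J] _ h Lh /=]; first split.
- split=> [x /UL1//|x y xL yL|y /Usurj1//].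
  by apply: Uinj; move: xL yL; rewrite !inE => /L1k ? /L1k.
- by move=> a x y /L1k Lx /L1k Ly; exact: Ulin.
- by move=> x y /L1k Lx /L1k Ly; exact: Uiso.
have [LK KP] := K_opP TC dimL k I J h.
have [LK' KP'] := K_opP TC' dimL' k I J (U h).
apply: (subspace_inner_ext (localization_subspace T' z 1)) => //.
  exact: UL1.
move=> _ /Usurj1 [v Lv <-]; have Lkh := L1k _ Lh; have Lkv := L1k _ Lv.
have La := (adjP TC dimL k J h).1.
rewrite Uiso//; last exact: L1k.
rewrite KP// KP'; last exact: UL1.
by rewrite -Uadj// -UNN// Uiso//; exact: shift_pow_localization.
Qed.

(* The defining relation of the graph of the unitary H^k -> H'^k extending V:
   x' is the vector that pairs with (N'^J)^* (V h) as x does with (N^J)^* h. *)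
Definition partner (V : H -> H') x x' := L' k x' /\
  forall J h, L 1%N h -> inner H' (NN' J x') (V h) = inner H (NN J x) h.

(** As [V] is onto [L' 1], the difference of two partners passes every test of
    [localization_test0]. *)
Lemma partner_unique (V : H -> H') :
  (forall h', L' 1%N h' -> exists2 h, L 1%N h & V h = h') ->
  forall x x' y', partner V x x' -> partner V x y' -> x' = y'.
Proof.
move=> Vsurj x x' y' [Lx xP] [Ly yP].
apply/eqP; rewrite -subr_eq0; apply/eqP.
have Lxy := subspaceB (localization_subspace T' z k) Lx Ly.
apply: (localization_test0 TC' Lxy) => I _ /Vsurj [h Lh <-].
by rewrite linearB innerBl xP// yP// subrr.
Qed.

(* The vectors (N^J)^* h with h in H^1 are orthogonal only to 0 in H^k, so it
   suffices to find partners for them. *)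
Lemma partner_total (V : H -> H') :
  (forall h, L 1%N h -> L' 1%N (V h)) ->
  (forall h', L' 1%N h' -> exists2 h, L 1%N h & V h = h') ->
  (forall I J h g, L 1%N h -> L 1%N g ->
    inner H' (adj' J (V h)) (adj' I (V g)) = inner H (adj J h) (adj I g)) ->
  forall y, L k y -> exists y', partner V y y' /\
    forall x x', L k x -> partner V x x' -> inner H' x' y' = inner H x y.
Proof.
move=> VL Vsurj Vgram.
have sL := localization_subspace T z k; have [L0 LP] := sL.
have sL' := localization_subspace T' z k; have [L0' LP'] := sL'.
(* The isometry clause belongs to [G] so that it passes to linear combinations along with the
   partners. *)
pose G := [set y | L k y /\ exists y', partner V y y' /\
    forall x x', L k x -> partner V x x' -> inner H' x' y' = inner H x y].
suff LG : L k `<=` G by move=> y /LG [].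
have Gadj J h : L 1%N h -> G (adj J h).
  move=> Lh; have [La aP] := adjP TC dimL k J h.
  have [La' aP'] := adjP TC' dimL' k J (V h).
  split=> //; exists (adj' J (V h)); split=> [|x x' Lx [Lx' xP]].
    split=> // I g Lg; rewrite -(inner_adj TC dimL) -(inner_adj TC' dimL').
    exact: Vgram.
  by rewrite -aP'// -aP// xP.
apply: (sub_of_orthogonal0 sL (localization_framed TC k dimL)) => [|y []//|].
  split.
    split=> //; exists 0; split=> [|x x' _ _]; last by rewrite !linear0r.
    by split=> // J h Lh; rewrite !linear0 !linear0l.
  move=> a x y [Lx [x' [[Lx' xP] xiso]]] [Ly [y' [[Ly' yP] yiso]]].
  split; first exact: LP.
  exists (a *: x' + y'); split.
    split=> [|J h Lh]; first exact: LP'.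
    by rewrite !shift_pow_linear !innerZDl xP// yP.
  by move=> w w' Lw ww'; rewrite !innerZDr (xiso w)// (yiso w).
move=> x Lx xG; apply: (localization_test0 TC Lx) => I h Lh.
by rewrite (adjP TC dimL k I h).2//; apply: xG; exact: Gadj.
Qed.

(** Both products vanish if a degree is at least [k]; a degree zero is settled by [V] being
    isometric. All other pairs lie in [K_indices], where [VK] applies. *)
Lemma inner_adj_transport (V : H -> H') :
  (forall h, L 1%N h -> L' 1%N (V h)) ->
  (forall h g, L 1%N h -> L 1%N g -> inner H' (V h) (V g) = inner H h g) ->
  (forall I J, K_indices m k (I, J) -> forall h, L 1%N h ->
    V (K_op T k z I J h) = K_op T' k z I J (V h)) ->
  forall I J h g, L 1%N h -> L 1%N g ->
    inner H' (adj' J (V h)) (adj' I (V g)) = inner H (adj J h) (adj I g).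
Proof.
move=> VL Viso VK I J h g Lh Lg; have VLh := VL _ Lh; have VLg := VL _ Lg.
have [kI|Ik] := leqP k (mdegree I).
  by rewrite (inner_adj_ge TC dimL)// (inner_adj_ge TC' dimL').
have [kJ|Jk] := leqP k (mdegree J).
  rewrite innerC [RHS]innerC.
  by rewrite (inner_adj_ge TC dimL)// (inner_adj_ge TC' dimL')// !rmorph0.
have [/mdegree0 ->|I0] := eqVneq (mdegree I) 0%N.
  by rewrite (inner_adj0 TC dimL)// (inner_adj0 TC' dimL')// Viso.
have [/mdegree0 ->|J0] := eqVneq (mdegree J) 0%N.
  rewrite innerC [RHS]innerC.
  rewrite (inner_adj0 TC dimL)// (inner_adj0 TC' dimL')//.
  by rewrite (negPf I0) !rmorph0.
have [LK KP] := K_opP TC dimL k I J h.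
have [LK' KP'] := K_opP TC' dimL' k I J (V h).
rewrite (inner_adj TC dimL) (inner_adj TC' dimL') -KP// -KP'//.
rewrite -VK// ?Viso// /K_indices /= !lt0n I0 J0 /=.
by rewrite -![(_ <= k - 1)%N]ltnS subn1 prednK// Ik Jk.
Qed.

End TwoTuples.

(** * Extending a unitary of the first order spaces to the localization spaces *)

Section Reconstruction.
Set Implicit Arguments.
Unset Strict Implicit.
Import Order.TTheory GRing.Theory Num.Theory.
Local Open Scope classical_set_scope.
Local Open Scope ring_scope.
Context {R : realType} {H H' : hilbertType R} {m : nat}.
Context (T : 'I_m -> {linear H -> H}) (T' : 'I_m -> {linear H' -> H'}).
Context (z : 'rV[Cplx R]_m) (n k : nat) (k0 : (0 < k)%N).
Context (TC : forall i j h, T i (T j h) = T j (T i h)).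
Context (TC' : forall i j h, T' i (T' j h) = T' j (T' i h)).
Context (dimL : has_dim n (joint_ker T z)).
Context (dimL' : has_dim n (joint_ker T' z)).
Local Notation L k := (localization T k z).
Local Notation L' k := (localization T' k z).

(** The extension sends a vector to its unique partner; uniqueness turns closure properties of the
    partner relation into linearity and intertwining. *)
Lemma localization_equivalence_of_K :
  unitarily_equivalent (K_indices m k)
    (L 1%N) (fun IJ => K_op T k z IJ.1 IJ.2)
    (L' 1%N) (fun IJ => K_op T' k z IJ.1 IJ.2) ->
  unitarily_equivalent setT (L k) (fun i => T i : H -> H)
    (L' k) (fun i => T' i : H' -> H').
Proof.
move=> [V [[VL Vinj Vsurj0] _ Viso] VK].
have Vsurj h' : L' 1%N h' -> exists2 h, L 1%N h & V h = h' by exact: Vsurj0.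
have gram := inner_adj_transport k0 TC TC' dimL dimL' VL Viso
  (fun I J => VK (I, J)).
pose V' h' := xget 0 [set h | L 1%N h /\ V h = h'].
have V'P h' : L' 1%N h' -> L 1%N (V' h') /\ V (V' h') = h'.
  move=> /Vsurj [h Lh Vh].
  by apply: (@xgetPex _ 0 [set h | L 1%N h /\ V h = h']); exists h.
have V'K h : L 1%N h -> V' (V h) = h.
  move=> Lh; have [L1 L2] := V'P _ (VL _ Lh).
  by apply: Vinj; rewrite ?inE.
have V'surj h : L 1%N h -> exists2 h', L' 1%N h' & V' h' = h.
  by move=> Lh; exists (V h); [exact: VL|exact: V'K].
have tot := partner_total TC TC' dimL dimL' VL Vsurj gram.
have uni := partner_unique TC' Vsurj.
(* Surjectivity: the existence result is used with the two tuples exchanged and [V'], the inverse of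
   [V] on [L' 1], in place of [V]. *)
have tot' : forall y', L' k y' -> exists2 y, L k y & partner T T' z k V y y'.
  move=> y' Ly'.
  have [|I J h g Lh Lg|y [[Ly yP] _]] :=
      @partner_total _ _ _ _ _ _ z n k TC' TC dimL' dimL V' _ V'surj _ y' Ly'.
  - by move=> h' /V'P [].
  - have [Lh1 Lh2] := V'P _ Lh; have [Lg1 Lg2] := V'P _ Lg.
    by rewrite -gram// Lh2 Lg2.
  exists y => //; split=> // J h Lh.
  by rewrite -yP ?V'K//; exact: VL.
have uni' := partner_unique TC V'surj.
have sL := localization_subspace T z k; have [L0 LP] := sL.
have sL' := localization_subspace T' z k; have [L0' LP'] := sL'.
pose U x := xget 0 [set x' | partner T T' z k V x x'].
have UP x : L k x -> partner T T' z k V x (U x).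
  move=> /tot [x' [xx' _]].
  by apply: (@xgetPex _ 0 [set x' | partner T T' z k V x x']); exists x'.
have Uuni x x' : L k x -> partner T T' z k V x x' -> U x = x'.
  by move=> /UP; exact: uni.
have Ulin (a : Cplx R) x y : L k x -> L k y -> U (a *: x + y) = a *: U x + U y.
  move=> Lx Ly; have [LU xP] := UP _ Lx; have [LU' yP] := UP _ Ly.
  apply: Uuni; first exact: LP.
  split=> [|J h Lh]; first exact: LP'.
  by rewrite !shift_pow_linear !innerZDl xP// yP.
have Uiso x y : L k x -> L k y -> inner H' (U x) (U y) = inner H x y.
  move=> Lx Ly; have [y' [yy' iso]] := tot _ Ly.
  by rewrite (Uuni _ _ Ly yy'); apply: iso => //; exact: UP.
(* The partner condition for [x] at [J] with entry [i] raised is the condition for its image under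
   the shift at [J]. *)
have UN i x : L k x -> U (shift_op T z i x) = shift_op T' z i (U x).
  move=> Lx; have [LU xP] := UP _ Lx; apply: Uuni.
    exact: shift_op_localization.
  split=> [|J h Lh]; first exact: shift_op_localization.
  by rewrite -!shift_pow_incr// xP.
exists U => [|i _ x Lx].
  split=> //; split=> [x /UP []//|x y|y' /tot' [y Ly yy']].
    rewrite !inE => Lx Ly Uxy; apply: (subspace_inner_ext sL) => // v Lv.
    by rewrite -!Uiso// Uxy.
  by exists y => //; exact: Uuni.
have TE : T i x = z ord0 i *: x + shift_op T z i x.
  by rewrite /shift_op addrC subrK.
rewrite TE Ulin//; last exact: shift_op_localization.
by rewrite UN// /shift_op addrC subrK.
Qed.

End Reconstruction.

Theorem theorem3p1 (R : realType) (m n k : nat)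
    (m_gt0 : (0 < m)%N) (n_gt0 : (0 < n)%N) (k_gt0 : (0 < k)%N)
    (Omega : set 'rV[Cplx R]_m) (domOmega : bounded_domain Omega)
    (H H' : hilbertType R)
    (T : 'I_m -> {linear H -> H}%R) (T' : 'I_m -> {linear H' -> H'}%R)
    (BT : class_B T n Omega) (BT' : class_B T' n Omega)
    (z : 'rV[Cplx R]_m) (Omegaz : Omega z) :
  unitarily_equivalent setT
    (localization T k z) (fun i => T i : H -> H)
    (localization T' k z) (fun i => T' i : H' -> H') <->
  unitarily_equivalent (K_indices m k)
    (localization T 1 z) (fun IJ => K_op T k z IJ.1 IJ.2)
    (localization T' 1 z) (fun IJ => K_op T' k z IJ.1 IJ.2).
Proof.
have [[_ TC] _ /(_ z Omegaz) dimT _] := BT.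
have [[_ TC'] _ /(_ z Omegaz) dimT' _] := BT'.
split.
  exact: (K_equivalence_of_localization k_gt0 TC TC' dimT dimT').
exact: (localization_equivalence_of_K k_gt0 TC TC' dimT dimT').
Qed.
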